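(* Let $S^{\downarrow}=(U, \Sigma, \eta^S, u_0)$ be the supervisor over the control constraint $(\Sigma_c, \Sigma_o)$ whose partial transition function $\eta^S$ is defined (from the observation automaton $M_O=(U,\Sigma_o,\eta,u_0)$) as follows: 1. for any $u \in U$ and any $\sigma \in \Sigma_o$ with $\eta(u,\sigma)!$, $\eta^S(u, \sigma)=\eta(u, \sigma)$; 2. for any $u \in U$ and any $\sigma \in \Sigma_{uc} \cap \Sigma_{uo}$, $\eta^S(u, \sigma)=u$; 3. for any $u \in U$ and any $\sigma \in \Sigma_{uc} \cap \Sigma_{o}$, if $\neg \eta(u, \sigma)!$, then $\eta^S(u, \sigma)=u_{\bot}$; and $\eta^S$ is undefined otherwise. Let $A^o$ be any non-empty safe attacker for $G^T \lVert M_O^T \lVert G_{SA}\lVert G_{AF}$. If $$L_m(G^T\lVert BT(S^{\downarrow})^{A} \lVert P_{\Sigma_o}(S^{\downarrow} \lVert G)^A \lVert G_{SA} \lVert G_{CE}\lVert A^o)\neq \varnothing,$$ then $A^o$ is damage-inflicting in $G^T\lVert BT(S)^{A} \lVert M^A \lVert G_{SA} \lVert G_{CE}\lVert A^o$, where $M^A=P_{\Sigma_o}(S\lVert G)^A$, for every supervisor $S$ that is consistent with $O$.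
   Context: **Automata.** A (partial, deterministic) finite automaton is $G=(Q,\Sigma,\delta,q_0,Q_m)$ with partial transition function $\delta:Q\times\Sigma\to Q$; $\delta(q,\sigma)!$ means defined. If $Q_m$ is omitted, all states are marked. $L(G)$, $L_m(G)$ are the closed and marked behaviors. $\lVert$ is the synchronous product: shared events are executed jointly, an event belonging to one alphabet only is executed by that component alone, marked states are products of marked states. $P_{\Sigma'}:\Sigma^*\to\Sigma'^*$ is the natural projection. For $G=(Q,\Sigma,\delta,q_0)$, $P_{\Sigma'}(G)=(2^Q,\Sigma,\Delta,UR(q_0))$ is an automaton over $\Sigma$, where $UR(q)=UR_{G,\Sigma-\Sigma'}(q)=\{\delta(q,s)\mid s\in(\Sigma-\Sigma')^*, \delta(q,s)!\}$, $UR(Q'')=\bigcup_{q\in Q''}UR(q)$; for $\varnothing\ne Q'\subseteq Q$: $\Delta(Q',\sigma)=UR(\delta(Q',\sigma))$ if $\sigma\in\Sigma'$ (possibly $\varnothing$), $\Delta(Q',\sigma)=Q'$ if $\sigma\in\Sigma-\Sigma'$; no transition is defined at state $\varnothing$. **Setting.** Plant $G=(Q,\Sigma,\delta,q_0)$ with a unique bad state $q_{bad}\neq q_0$, which is deadlocked. $\Sigma_o,\Sigma_c\subseteq\Sigma$ are the observable and controllable events, $\Sigma_{uo}=\Sigma-\Sigma_o$, $\Sigma_{uc}=\Sigma-\Sigma_c$. A supervisor over a control constraint (controllable events, observable events) is a finite automaton in which every uncontrollable event is defined at every state and every unobservable event, where defined, is a self-loop. A ''supervisor'' $S=(X,\Sigma,\zeta,x_0)$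 is over $(\Sigma_c,\Sigma_o)$; its control command at $x$ is $\Gamma(x)=\{\sigma\in\Sigma\mid\zeta(x,\sigma)!\}$, and $\Gamma=\{\gamma\subseteq\Sigma\mid\Sigma_{uc}\subseteq\gamma\}$ is the set of all control commands (also used as events). $O$ is a prefix-closed finite set with $O\subseteq P_{\Sigma_o}(L(S_0\lVert G))$ for some supervisor $S_0$; $O=L(M_O)$ with $M_O=(U,\Sigma_o,\eta,u_0)$ having exactly one deadlocked state $u_\bot$, with $\eta(u_0,s)=u_\bot$ for every prefix-maximal $s\in O$. $S$ is consistent with $O$ if $O\subseteq P_{\Sigma_o}(L(S\lVert G))$. Attack constraint: $\Sigma_{a,A}\subseteq\Sigma_c$, $\Sigma_{s,A}\subseteq\Sigma_o$, and $R\subseteq\Sigma_{s,A}\times\Sigma_{s,A}$ with $\sigma\in R[\sigma]:=\{\sigma'\mid(\sigma,\sigma')\in R\}$ and $R[\sigma]-\{\sigma\}\ne\varnothing$ for all $\sigma\in\Sigma_{s,A}$. $\Sigma_{s,A}^{\#}=\{\sigma^{\#}\mid\sigma\in\Sigma_{s,A}\}$ is a relabelled copy and $\$$ is a new event. An attacker is a supervisor $A=(Y,\Sigma\cup\Sigma_{s,A}^{\#}\cup\{\$\}\cup\Gamma,\beta,y_0)$ over the control constraint $(\Sigma_{a,A}\cup\Sigma_{s,A}^{\#},\Sigma_o\cup\Sigma_{s,A}^{\#})$. **Surrogate components.** (Only the listed transitions are defined.) - $G^T=(Q\cup\{q^{\$}\},\Sigma\cup\Sigma_{s,A}^{\#}\cup\{\$\}\cup\Gamma,\delta^T,q_0,\{q_{bad}\})$: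 $\delta^T(q,\sigma)=\delta(q,\sigma)$ for $q\in Q,\sigma\in\Sigma$; for $q\in Q-\{q_{bad}\}$: $\delta^T(q,\$)=q^{\$}$, and $\delta^T(q,\sigma)=q$ for $\sigma\in\Sigma_{s,A}^{\#}\cup\Gamma$. - $G_{SA}=(Q^{SA},\Sigma\cup\Sigma_{s,A}^{\#},\delta^{SA},q_{init})$, $Q^{SA}=\{q^\sigma\mid\sigma\in\Sigma_{s,A}\}\cup\{q_{init}\}$: $\delta^{SA}(q_{init},\sigma)=q^\sigma$ for $\sigma\in\Sigma_{s,A}$; $\delta^{SA}(q^\sigma,\sigma'^{\#})=q_{init}$ for $\sigma'\in R[\sigma]$; $\delta^{SA}(q_{init},\sigma)=q_{init}$ for $\sigma\in\Sigma-\Sigma_{s,A}$. - $M_O^T=(U\cup\{u^!,u^{\$}\},(\Sigma_o-\Sigma_{s,A})\cup\Sigma_{s,A}^{\#}\cup\{\$\},\eta^T,u_0,U\cup\{u^!\})$: for $u\in U$, $\sigma\in\Sigma_o-\Sigma_{s,A}$ (resp. $\sigma\in\Sigma_{s,A}$), $\eta^T(u,\sigma)$ (resp. $\eta^T(u,\sigma^{\#})$) equals $\eta(u,\sigma)$ if $\eta(u,\sigma)!$ and $u^!$ otherwise; every event of $(\Sigma_o-\Sigma_{s,A})\cup\Sigma_{s,A}^{\#}$ is a self-loop at $u^!$; $\eta^T(u^!,\$)=u^{\$}$. - $G_{AF}=(Q^{AF},\Sigma_{s,A}\cup\Sigma_{s,A}^{\#}\cup\{\$\},\delta^{AF},q_0^{AF},\{q^{AF,!}\})$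 with $Q^{AF}=\{q^{AF,\sigma}\mid\sigma\in\Sigma_{s,A}\}\cup\{q_0^{AF},q^{AF,!},q^{AF,\$}\}$: for $\sigma,\sigma'\in\Sigma_{s,A}$, $\delta^{AF}(q_0^{AF},\sigma)=q^{AF,\sigma}$; $\delta^{AF}(q^{AF,\sigma},\sigma^{\#})=q_0^{AF}$; $\delta^{AF}(q^{AF,\sigma},\sigma'^{\#})=q^{AF,!}$ for $\sigma'\ne\sigma$; $\delta^{AF}(q^{AF,!},\$)=q^{AF,\$}$. An attacker $A$ is safe for $G^T\lVert M_O^T\lVert G_{SA}\lVert G_{AF}$ if no state of $\mathbf{BAD}=\{(q^{\$},u^{\$},q^{SA},q^{AF,\$})\mid q^{SA}\in Q^{SA}\}$ is reached in $G^T\lVert M_O^T\lVert G_{SA}\lVert G_{AF}\lVert A$; it is non-empty if $L_m(G^T\lVert M_O^T\lVert G_{SA}\lVert G_{AF}\lVert A)\neq\varnothing$. **Attacked closed-loop components** (for a supervisor $S$). - $BT(S)^A=(X\cup X_{com}\cup\{x^!\},\Sigma\cup\Sigma_{s,A}^{\#}\cup\Gamma,\zeta^{BT,A},x_{0,com})$, $X_{com}=\{x_{com}\mid x\in X\}$ a disjoint copy of $X$: for $x\in X$, (1) $\zeta^{BT,A}(x_{com},\Gamma(x))=x$; (2) for $\sigma\in\Sigma_{uo}$ with $\zeta(x,\sigma)!$, $\zeta^{BT,A}(x,\sigma)=x$; (3) for $\sigma\in\Sigma_o-\Sigma_{s,A}$ with $\zeta(x,\sigma)!$, $\zeta^{BT,A}(x,\sigma)=\zeta(x,\sigma)_{com}$;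 (4) for $\sigma\in\Sigma_{s,A}$, $\zeta^{BT,A}(x,\sigma^{\#})=\zeta(x,\sigma)_{com}$ if $\zeta(x,\sigma)!$, and $=x^!$ otherwise; (5) each $\sigma\in\Sigma_{s,A}$ is a self-loop at every state of $X\cup X_{com}$. - With the monitor $M=P_{\Sigma_o}(S\lVert G)$, transition function $\Delta$: $M^A=P_{\Sigma_o}(S\lVert G)^A=(2^{X\times Q}\cup\{D^{\$}\},\Sigma\cup\Sigma_{s,A}^{\#}\cup\{\$\}\cup\Gamma,\Delta^A,UR_{S\lVert G,\Sigma-\Sigma_o}(x_0,q_0),2^{X\times Q})$: for $D\subseteq X\times Q$, $\Delta^A(D,\sigma)=\Delta(D,\sigma)$ for $\sigma\in\Sigma-\Sigma_{s,A}$; $\Delta^A(D,\sigma^{\#})=\Delta(D,\sigma)$ for $\sigma\in\Sigma_{s,A}$; $\Delta^A(\varnothing,\$)=D^{\$}$; $\Delta^A(D,\sigma)=D$ for $D\neq\varnothing$, $\sigma\in\Sigma_{s,A}\cup\Gamma$. - $G_{CE}=(\{q^\gamma\mid\gamma\in\Gamma\}\cup\{q_{wait}\},\Sigma\cup\Gamma,\delta^{CE},q_{wait})$: $\delta^{CE}(q_{wait},\gamma)=q^\gamma$; $\delta^{CE}(q^\gamma,\sigma)=q^\gamma$ for $\sigma\in\Sigma_{uo}\cap\gamma$; $\delta^{CE}(q^\gamma,\sigma)=q_{wait}$ for $\sigma\in\Sigma_o\cap\gamma$. $A$ is damage-inflicting (damage-reachable) in $G^T\lVert BT(S)^{A}\lVert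 M^A\lVert G_{SA}\lVert G_{CE}\lVert A$ if $L_m$ of this automaton is non-empty, i.e., $q_{bad}$ can be reached. *)

(* Defs.v *)
From HB Require Import structures.
From mathcomp Require Import all_boot.

Set Implicit Arguments.
Unset Strict Implicit.
Unset Printing Implicit Defensive.
#[local] Set Warnings "-redundant-canonical-projection".

(* The alphabet of an automaton is a subset of an ambient finite type of      *)
(* events.  Only the restriction of [trans] to the alphabet is meaningful:    *)
(* the partial transition function is [delta] below, with [None] standing for *)
(* "undefined".                                                               *)
Record automaton (E Q : finType) := Automaton {
  alph : {set E};
  trans : Q -> E -> option Q;
  init : Q;
  marked : {set Q}
}.

Section Automata.
Context {E : finType}.

Definition delta {Q : finType} (G : automaton E Q) (q : Q) (e : E) : option Q :=
  if e \in alph G then trans G q e else None.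

Definition run {Q : finType} (G : automaton E Q) (q : Q) (s : seq E) : option Q :=
  foldl (fun oq e => obind (fun p => delta G p e) oq) (Some q) s.

Definition closed_behavior {Q : finType} (G : automaton E Q) (s : seq E) : Prop :=
  exists q, run G (init G) s = Some q.

Definition marked_behavior {Q : finType} (G : automaton E Q) (s : seq E) : Prop :=
  exists2 q, run G (init G) s = Some q & q \in marked G.

Definition deadlocked {Q : finType} (G : automaton E Q) (q : Q) : Prop :=
  forall e, delta G q e = None.

Definition sync_trans {Q1 Q2 : finType} (G1 : automaton E Q1)
    (G2 : automaton E Q2) (q : Q1 * Q2) (e : E) : option (Q1 * Q2) :=
  let q1' := if e \in alph G1 then delta G1 q.1 e else Some q.1 in
  let q2' := if e \in alph G2 then delta G2 q.2 e else Some q.2 in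
  if q1' is Some p1 then omap (pair p1) q2' else None.

Definition sync {Q1 Q2 : finType} (G1 : automaton E Q1) (G2 : automaton E Q2) :
    automaton E (Q1 * Q2)%type :=
  {| alph := alph G1 :|: alph G2;
     trans := sync_trans G1 G2;
     init := (init G1, init G2);
     marked := setX (marked G1) (marked G2) |}.

Definition proj (S' : {set E}) (s : seq E) : seq E := [seq e <- s | e \in S'].

(* [UR_{G,T}(q)]; the characterization by strings over [T] is [URP].          *)
Definition UR {Q : finType} (G : automaton E Q) (T : {set E}) (q : Q) : {set Q} :=
  [set p | connect [rel a b | [exists e in T, delta G a e == Some b]] q p].

Definition URset {Q : finType} (G : automaton E Q) (T : {set E}) (D : {set Q}) :
    {set Q} :=
  \bigcup_(q in D) UR G T q.

Definition delta_set {Q : finType} (G : automaton E Q) (D : {set Q}) (e : E) :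
    {set Q} :=
  [set p | [exists q in D, delta G q e == Some p]].

Definition proj_aut {Q : finType} (S' : {set E}) (G : automaton E Q) :
    automaton E {set Q} :=
  {| alph := alph G;
     trans := fun D e =>
       if D == set0 then None
       else if e \in S' then Some (URset G (alph G :\: S') (delta_set G D e))
       else Some D;
     init := UR G (alph G :\: S') (init G);
     marked := setT |}.

(* Supervisor with alphabet [A] over the control constraint [(Sc, So)].       *)
Definition supervisor {X : finType} (A Sc So : {set E}) (S : automaton E X) :
    Prop :=
  [/\ alph S = A,
      marked S = setT,
      (forall x e, e \in A :\: Sc -> delta S x e <> None) &
      (forall x e x', e \in A :\: So -> delta S x e = Some x' -> x' = x)].

Lemma run_cat (Q : finType) (G : automaton E Q) (q p : Q) (s t : seq E) :
  run G q s = Some p -> run G q (s ++ t) = run G p t.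
Proof. by rewrite /run foldl_cat => ->. Qed.

Lemma URP (Q : finType) (G : automaton E Q) (T : {set E}) (q p : Q) :
  reflect (exists2 s, all [in T] s & run G q s = Some p) (p \in UR G T q).
Proof.
rewrite inE; apply: (iffP connectP) => [[l]|[s]].
  elim/last_ind: l p => [p _ ->|l b IH p]; first by exists [::].
  rewrite rcons_path last_rcons => /andP[/IH/(_ erefl)[s sT rs] /=].
  case/exists_inP => e eT /eqP de ->.
  exists (rcons s e); first by rewrite all_rcons sT andbT.
  by rewrite -cats1 (run_cat _ rs) /run /= de.
elim: s q => [q _ [->]|e s IH q /= /andP[eT sT]]; first by exists [::].
rewrite /run /=; case de: (delta G q e) => [r|]; last first.
  by elim: s {IH sT} => //=.
move=> /(IH r sT)[l pl ->]; exists (r :: l) => //=.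
by rewrite pl andbT; apply/exists_inP; exists e; rewrite ?de.
Qed.

End Automata.

(* The events of the attacked system: [Plain s], [Hash s], [Dollar], [Cmd g]  *)
(* are sigma, sigma^#, $ and the control command gamma.  [Hash s] with s not  *)
(* in Sigma_{s,A} and [Cmd g] with g not in Gamma belong to no alphabet.      *)
Inductive event (Ev : finType) :=
  Plain of Ev | Hash of Ev | Dollar | Cmd of {set Ev}.
Arguments Dollar {Ev}.

Section EventFinite.
Variable Ev : finType.

Definition event_code (e : event Ev) : option (Ev + Ev + {set Ev}) :=
  match e with
  | Plain s => Some (inl (inl s))
  | Hash s => Some (inl (inr s))
  | Cmd g => Some (inr g)
  | Dollar => None
  end.

Definition event_decode (c : option (Ev + Ev + {set Ev})) : event Ev :=
  match c with
  | Some (inl (inl s)) => Plain s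
  | Some (inl (inr s)) => Hash s
  | Some (inr g) => Cmd g
  | None => Dollar
  end.

Lemma event_codeK : cancel event_code event_decode.
Proof. by case. Qed.

HB.instance Definition _ := Countable.copy (event Ev) (can_type event_codeK).
HB.instance Definition _ : isFinite (event Ev) := CanIsFinite event_codeK.

End EventFinite.

(* [U], u^! and u^$.                                                          *)
Inductive mot_state (U : finType) := MotSt of U | MotBang | MotDollar.
Arguments MotBang {U}.
Arguments MotDollar {U}.

Section MotFinite.
Variable U : finType.

Definition mot_code (u : mot_state U) : U + bool :=
  match u with
  | MotSt u => inl u
  | MotBang => inr true
  | MotDollar => inr false
  end.

Definition mot_decode (c : U + bool) : mot_state U :=
  match c with
  | inl u => MotSt u
  | inr true => MotBang
  | inr false => MotDollar
  end.

Lemma mot_codeK : cancel mot_code mot_decode.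
Proof. by case. Qed.

HB.instance Definition _ := Countable.copy (mot_state U) (can_type mot_codeK).
HB.instance Definition _ : isFinite (mot_state U) := CanIsFinite mot_codeK.

End MotFinite.

(* q_0^{AF}, q^{AF,sigma}, q^{AF,!} and q^{AF,$}.                             *)
Inductive af_state (Ev : finType) := AfInit | AfEv of Ev | AfBang | AfDollar.
Arguments AfInit {Ev}.
Arguments AfBang {Ev}.
Arguments AfDollar {Ev}.

Section AfFinite.
Variable Ev : finType.

Definition af_code (q : af_state Ev) : Ev + option bool :=
  match q with
  | AfEv s => inl s
  | AfInit => inr None
  | AfBang => inr (Some true)
  | AfDollar => inr (Some false)
  end.

Definition af_decode (c : Ev + option bool) : af_state Ev :=
  match c with
  | inl s => AfEv s
  | inr None => AfInit
  | inr (Some true) => AfBang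
  | inr (Some false) => AfDollar
  end.

Lemma af_codeK : cancel af_code af_decode.
Proof. by case. Qed.

HB.instance Definition _ := Countable.copy (af_state Ev) (can_type af_codeK).
HB.instance Definition _ : isFinite (af_state Ev) := CanIsFinite af_codeK.

End AfFinite.

(* [X], its copy X_com, and x^!.                                              *)
Inductive bt_state (X : finType) := BtSt of X | BtCom of X | BtBang.
Arguments BtBang {X}.

Section BtFinite.
Variable X : finType.

Definition bt_code (x : bt_state X) : option (X + X) :=
  match x with
  | BtSt x => Some (inl x)
  | BtCom x => Some (inr x)
  | BtBang => None
  end.

Definition bt_decode (c : option (X + X)) : bt_state X :=
  match c with
  | Some (inl x) => BtSt x
  | Some (inr x) => BtCom x
  | None => BtBang
  end.

Lemma bt_codeK : cancel bt_code bt_decode.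
Proof. by case. Qed.

HB.instance Definition _ := Countable.copy (bt_state X) (can_type bt_codeK).
HB.instance Definition _ : isFinite (bt_state X) := CanIsFinite bt_codeK.

End BtFinite.

(* Throughout, the alphabet Sigma is the whole finite type [Ev].              *)
Section Setting.
Context {Ev : finType}.

Definition plain (A : {set Ev}) : {set event Ev} := [set Plain s | s in A].
Definition hash (A : {set Ev}) : {set event Ev} := [set Hash s | s in A].

Definition commands (Sc : {set Ev}) : {set {set Ev}} := [set g : {set Ev} | ~: Sc \subset g].
Definition cmds (Sc : {set Ev}) : {set event Ev} := [set Cmd g | g in commands Sc].

Definition command {X : finType} (S : automaton Ev X) (x : X) : {set Ev} :=
  [set s | delta S x s != None :> option X].

Definition plant {Q : finType} (G : automaton Ev Q) (qbad : Q) : Prop :=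
  [/\ alph G = setT, marked G = setT, qbad <> init G & deadlocked G qbad].

Definition consistent {X Q : finType} (So : {set Ev}) (G : automaton Ev Q)
    (O : seq (seq Ev)) (S : automaton Ev X) : Prop :=
  forall s, s \in O -> exists2 t, closed_behavior (sync S G) t & proj So t = s.

(* The finite set of strings [O] is given by a list of its elements.          *)
Definition observations {Q : finType} (Sc So : {set Ev}) (G : automaton Ev Q)
    (O : seq (seq Ev)) : Prop :=
  (forall s t, s \in O -> prefix t s -> t \in O) /\
  (exists (X0 : finType) (S0 : automaton Ev X0),
     supervisor setT Sc So S0 /\ consistent So G O S0).

Definition prefix_maximal (O : seq (seq Ev)) (s : seq Ev) : Prop :=
  s \in O /\ (forall t, t \in O -> prefix s t -> t = s).

Definition observation_automaton {U : finType} (So : {set Ev})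
    (O : seq (seq Ev)) (MO : automaton Ev U) (ubot : U) : Prop :=
  [/\ alph MO = So,
      marked MO = setT,
      (forall s, s \in O <-> closed_behavior MO s),
      (forall u, deadlocked MO u <-> u = ubot) &
      (forall s, prefix_maximal O s -> run MO (init MO) s = Some ubot)].

Definition rel_image (R : {set Ev * Ev}) (s : Ev) : {set Ev} :=
  [set s' | (s, s') \in R].

Definition attack_constraint (Sc So SaA SsA : {set Ev}) (R : {set Ev * Ev}) :
    Prop :=
  [/\ SaA \subset Sc,
      SsA \subset So,
      R \subset setX SsA SsA &
      forall s, s \in SsA ->
        s \in rel_image R s /\ rel_image R s :\: [set s] <> set0].

Definition attacker {Y : finType} (Sc So SaA SsA : {set Ev})
    (A : automaton (event Ev) Y) : Prop :=
  supervisor (plain setT :|: hash SsA :|: [set Dollar] :|: cmds Sc)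
    (plain SaA :|: hash SsA) (plain So :|: hash SsA) A.

(* [None] is q^$.                                                             *)
Definition GT {Q : finType} (Sc SsA : {set Ev}) (G : automaton Ev Q) (qbad : Q) :
    automaton (event Ev) (option Q) :=
  {| alph := plain setT :|: hash SsA :|: [set Dollar] :|: cmds Sc;
     trans := fun oq e =>
       if oq is Some q then
         match e with
         | Plain s => omap Some (delta G q s)
         | Dollar => if q != qbad then Some None else None
         | Hash _ | Cmd _ => if q != qbad then Some (Some q) else None
         end
       else None;
     init := Some (init G);
     marked := [set Some qbad] |}.

(* [None] is q_init and [Some s] is q^s; the states [Some s] with s not in    *)
(* [SsA] are unreachable.                                                     *)
Definition GSA (SsA : {set Ev}) (R : {set Ev * Ev}) :
    automaton (event Ev) (option Ev) :=
  {| alph := plain setT :|: hash SsA;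
     trans := fun q e =>
       match q, e with
       | None, Plain s => if s \in SsA then Some (Some s) else Some None
       | Some s, Hash s' => if s' \in rel_image R s then Some None else None
       | _, _ => None
       end;
     init := None;
     marked := setT |}.

Definition MOT_step {U : finType} (MO : automaton Ev U) (u : U) (s : Ev) :
    mot_state U :=
  if delta MO u s is Some u' then MotSt u' else MotBang.

Definition MOT {U : finType} (So SsA : {set Ev}) (MO : automaton Ev U) :
    automaton (event Ev) (mot_state U) :=
  {| alph := plain (So :\: SsA) :|: hash SsA :|: [set Dollar];
     trans := fun u e =>
       match u, e with
       | MotSt u, (Plain s | Hash s) => Some (MOT_step MO u s)
       | MotBang, (Plain _ | Hash _) => Some MotBang
       | MotBang, Dollar => Some MotDollar
       | _, _ => None
       end;
     init := MotSt (init MO);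
     marked := [set~ MotDollar] |}.

(* The states [AfEv s] with s not in [SsA] are unreachable.                   *)
Definition GAF (SsA : {set Ev}) : automaton (event Ev) (af_state Ev) :=
  {| alph := plain SsA :|: hash SsA :|: [set Dollar];
     trans := fun q e =>
       match q, e with
       | AfInit, Plain s => Some (AfEv s)
       | AfEv s, Hash s' => if s' == s then Some AfInit else Some AfBang
       | AfBang, Dollar => Some AfDollar
       | _, _ => None
       end;
     init := AfInit;
     marked := [set AfBang] |}.

Definition surrogate {Q U : finType} (Sc So SsA : {set Ev}) (R : {set Ev * Ev})
    (G : automaton Ev Q) (qbad : Q) (MO : automaton Ev U) :
    automaton (event Ev)
      (option Q * mot_state U * option Ev * af_state Ev)%type :=
  sync (sync (sync (GT Sc SsA G qbad) (MOT So SsA MO)) (GSA SsA R)) (GAF SsA).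

Definition BAD (Q U : finType) :
    {set option Q * mot_state U * option Ev * af_state Ev} :=
  [set (None, MotDollar, qSA, AfDollar) | qSA : option Ev].

Definition safe {Q U Y : finType} (Sc So SsA : {set Ev}) (R : {set Ev * Ev})
    (G : automaton Ev Q) (qbad : Q) (MO : automaton Ev U)
    (A : automaton (event Ev) Y) : Prop :=
  let GA := sync (surrogate Sc So SsA R G qbad MO) A in
  forall s q y, run GA (init GA) s = Some (q, y) -> q \notin BAD Q U.

Definition nonempty_attacker {Q U Y : finType} (Sc So SsA : {set Ev})
    (R : {set Ev * Ev}) (G : automaton Ev Q) (qbad : Q) (MO : automaton Ev U)
    (A : automaton (event Ev) Y) : Prop :=
  exists s, marked_behavior (sync (surrogate Sc So SsA R G qbad MO) A) s.

(* The alphabet excludes [Hash s] for s not in [SsA].                         *)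
Definition BTA {X : finType} (Sc So SsA : {set Ev}) (S : automaton Ev X) :
    automaton (event Ev) (bt_state X) :=
  {| alph := plain setT :|: hash SsA :|: cmds Sc;
     trans := fun b e =>
       match b, e with
       | BtCom x, Cmd g => if g == command S x then Some (BtSt x) else None
       | BtSt x, Plain s =>
           if s \in SsA then Some (BtSt x)
           else if s \in So then omap (@BtCom X) (delta S x s)
           else if delta S x s is Some _ then Some (BtSt x) else None
       | BtCom x, Plain s => if s \in SsA then Some (BtCom x) else None
       | BtSt x, Hash s =>
           if delta S x s is Some x' then Some (BtCom x') else Some BtBang
       | _, _ => None
       end;
     init := BtCom (init S);
     marked := setT |}.

(* [None] is D^$; [M] is the monitor P_{Sigma_o}(S || G).                     *)
Definition monitorA {T : finType} (Sc SsA : {set Ev}) (M : automaton Ev {set T}) :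
    automaton (event Ev) (option {set T}) :=
  {| alph := plain setT :|: hash SsA :|: [set Dollar] :|: cmds Sc;
     trans := fun oD e =>
       if oD is Some D then
         match e with
         | Plain s =>
             if s \in SsA then (if D != set0 then Some (Some D) else None)
             else omap Some (delta M D s)
         | Hash s => omap Some (delta M D s)
         | Dollar => if D == set0 then Some None else None
         | Cmd _ => if D != set0 then Some (Some D) else None
         end
       else None;
     init := Some (init M);
     marked := [set~ None] |}.

(* [None] is q_wait and [Some g] is q^g; the states [Some g] with g not a     *)
(* control command are unreachable.                                           *)
Definition GCE (Sc So : {set Ev}) : automaton (event Ev) (option {set Ev}) :=
  {| alph := plain setT :|: cmds Sc;
     trans := fun (q : option {set Ev}) e =>
       match q, e with
       | None, Cmd g => Some (Some g)
       | Some g, Plain s =>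
           if s \in g then (if s \in So then Some None else Some (Some g))
           else None
       | _, _ => None
       end;
     init := None;
     marked := setT |}.

Definition attacked_loop {Q X Y : finType} (Sc So SsA : {set Ev})
    (R : {set Ev * Ev}) (G : automaton Ev Q) (qbad : Q) (S : automaton Ev X)
    (A : automaton (event Ev) Y) :=
  sync (sync (sync (sync (sync
    (GT Sc SsA G qbad)
    (BTA Sc So SsA S))
    (monitorA Sc SsA (proj_aut So (sync S G))))
    (GSA SsA R))
    (GCE Sc So))
    A.

Definition damage_inflicting {Q X Y : finType} (Sc So SsA : {set Ev})
    (R : {set Ev * Ev}) (G : automaton Ev Q) (qbad : Q) (S : automaton Ev X)
    (A : automaton (event Ev) Y) : Prop :=
  exists s, marked_behavior (attacked_loop Sc So SsA R G qbad S A) s.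

Definition Sdown {U : finType} (Sc So : {set Ev}) (MO : automaton Ev U) (ubot : U) :
    automaton Ev U :=
  {| alph := setT;
     trans := fun u s =>
       if s \in So then
         if delta MO u s is Some u' then Some u'
         else if s \notin Sc then Some ubot else None
       else if s \notin Sc then Some u else None;
     init := init MO;
     marked := setT |}.

Lemma Sdown_supervisor (U : finType) (Sc So : {set Ev}) (MO : automaton Ev U)
    (ubot : U) : supervisor setT Sc So (Sdown Sc So MO ubot).
Proof.
split=> // [x e|x e x']; rewrite !inE andbT /delta inE /= => h.
  by rewrite h; case: ifP => // _; case: (delta MO x e).
by rewrite (negPf h); case: ifP => // _ [].
Qed.

End Setting.

(* Main.v *)
(* The closed behavior of [Sdown] is contained in that of every consistent    *)

(* Whatever [Sdown] enables, a consistent supervisor [S] enables too after the same observation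
   ([same_observation_step]). Inside [O], the longer observation is realized by a string of the
   closed loop of [S], and its projection drives [S] to the same state because unobservable events
   are self-loops. Any other event that [Sdown] allows is uncontrollable, so [S] cannot disable it.

   An attacked run under [Sdown] is therefore replayed under [S], each command being replaced by the
   larger one that [S] issues. The attacker cannot tell the difference: it neither observes nor
   controls commands. The estimate of the monitor of [S] contains a copy of that of the monitor of
   [Sdown] ([sub_estimate_step]), so it raises no earlier alarm. When the [Sdown] estimate becomes
   empty, either the plant has just reached [qbad], and so has the replay, or only [$] can still
   occur and no marked state is reachable ([doomed_step]). [loop_sim_step] treats one event,
   [loop_sim_run] a whole run. *)
(* supervisor S: along O both follow the same observation, and once O is left *)
(* [Sdown] enables uncontrollable events only.  Hence an attacked run under   *)
(* [Sdown] is mimicked under S by replacing each control command by the one   *)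
(* that S issues, which is invisible to the attacker.  The monitor of S then  *)
(* stays nonempty as long as that of [Sdown] does, and a run on which the     *)
(* latter becomes empty is stuck, hence has just reached the bad state or     *)
(* never will.                                                                *)
Require Import Defs.
From mathcomp Require Import all_boot.

Set Implicit Arguments.
Unset Strict Implicit.
Unset Printing Implicit Defensive.

(** * Runs of synchronous products and of supervisors *)

Section Runs.
Context {E : finType}.

(** Unlike [delta], this lets a component idle on foreign events, so that a step of a product splits
    into steps of its factors without case analysis on alphabets ([lstep_sync]). *)
Definition lstep {Q : finType} (G : automaton E Q) (q : Q) (e : E) : option Q :=
  if e \in alph G then trans G q e else Some q.

Lemma deltaE (Q : finType) (G : automaton E Q) (q p : Q) (e : E) :
  delta G q e = Some p <-> e \in alph G /\ lstep G q e = Some p.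
Proof. by rewrite /delta /lstep; case: ifP => _; split=> // -[]. Qed.

Lemma lstep_sync (Q1 Q2 : finType) (G1 : automaton E Q1) (G2 : automaton E Q2)
    (q p : Q1 * Q2) (e : E) :
  lstep (sync G1 G2) q e = Some p <->
  lstep G1 q.1 e = Some p.1 /\ lstep G2 q.2 e = Some p.2.
Proof.
case: q p => [q1 q2] [p1 p2]; rewrite /lstep /= /sync_trans /delta inE.
case: ifP => [_|/norP[/negPf-> /negPf->]]; last by split=> [[-> ->]|[[->] [->]]].
set o1 := if _ then _ else Some q1; set o1' := if _ then _ else Some q1.
have -> : o1 = o1' by rewrite /o1 /o1'; case: (e \in alph G1).
set o2 := if _ then _ else Some q2; set o2' := if _ then _ else Some q2.
have -> : o2 = o2' by rewrite /o2 /o2'; case: (e \in alph G2).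
by case: o1' => [a|]; case: o2' => [b|] /=; split=> [|[]] // => [[-> ->]|[->] [->]].
Qed.

Lemma run_rcons (Q : finType) (G : automaton E Q) (q : Q) (s : seq E) (e : E) :
  run G q (rcons s e) = obind (fun p => delta G p e) (run G q s).
Proof. by rewrite /run foldl_rcons. Qed.

Lemma run_rconsP (Q : finType) (G : automaton E Q) (q p : Q) (s : seq E) (e : E) :
  run G q (rcons s e) = Some p <->
  exists2 r, run G q s = Some r & delta G r e = Some p.
Proof.
rewrite run_rcons; case: (run G q s) => [r|] /=; last by split=> // -[].
by split=> [|[_ [<-]]] //; exists r.
Qed.

Lemma delta_sync_setT (Q1 Q2 : finType) (G1 : automaton E Q1)
    (G2 : automaton E Q2) (q p : Q1 * Q2) (e : E) :
  alph G1 = setT -> alph G2 = setT ->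
  delta (sync G1 G2) q e = Some p <->
  delta G1 q.1 e = Some p.1 /\ delta G2 q.2 e = Some p.2.
Proof.
move=> a1 a2; have := lstep_sync G1 G2 q p e; have := deltaE (sync G1 G2) q p e.
have := deltaE G1 q.1 p.1 e; have := deltaE G2 q.2 p.2 e.
by rewrite /= a1 a2 !inE; tauto.
Qed.

Lemma run_sync_fst (Q1 Q2 : finType) (G1 : automaton E Q1)
    (G2 : automaton E Q2) (q p : Q1 * Q2) (s : seq E) :
  alph G1 = setT -> alph G2 = setT ->
  run (sync G1 G2) q s = Some p -> run G1 q.1 s = Some p.1.
Proof.
move=> a1 a2; elim/last_ind: s p => [p [->]|s e IH p] //.
case/run_rconsP=> r /IH run1 /(delta_sync_setT _ _ _ a1 a2)[d1 _].
by apply/run_rconsP; exists r.1.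
Qed.

(** Unobservable events are self-loops, so the state of a supervisor depends only on the
    observation. *)
Lemma run_proj (X : finType) (Sc So : {set E}) (S : automaton E X) (x x' : X)
    (s : seq E) :
  supervisor setT Sc So S ->
  run S x s = Some x' -> run S x (proj So s) = Some x'.
Proof.
case=> _ _ _ loop; elim/last_ind: s x' => [//|s e IH x'] /run_rconsP[r /IH rs d].
rewrite /proj filter_rcons; case: ifP => eSo; first by apply/run_rconsP; exists r.
by rewrite (loop r e x') // !inE eSo.
Qed.

End Runs.

(** * Membership of events in the alphabets *)

Section Events.
Context {Ev : finType}.

Lemma mem_plain (A : {set Ev}) (s : Ev) : (Plain s \in plain A) = (s \in A).
Proof. by apply: mem_imset => a b []. Qed.

Lemma mem_hash (A : {set Ev}) (s : Ev) : (Hash s \in hash A) = (s \in A).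
Proof. by apply: mem_imset => a b []. Qed.

Lemma mem_cmds (Sc g : {set Ev}) : (Cmd g \in cmds Sc) = (~: Sc \subset g).
Proof. by rewrite mem_imset ?inE // => a b []. Qed.

Lemma plain_hash (A : {set Ev}) (s : Ev) : (Plain s \in hash A) = false.
Proof. by apply/imsetP => -[]. Qed.

Lemma plain_cmds (Sc : {set Ev}) (s : Ev) : (Plain s \in cmds Sc) = false.
Proof. by apply/imsetP => -[]. Qed.

Lemma hash_plain (A : {set Ev}) (s : Ev) : (Hash s \in plain A) = false.
Proof. by apply/imsetP => -[]. Qed.

Lemma hash_cmds (Sc : {set Ev}) (s : Ev) : (Hash s \in cmds Sc) = false.
Proof. by apply/imsetP => -[]. Qed.

Lemma cmd_plain (A g : {set Ev}) : (Cmd g \in plain A) = false.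
Proof. by apply/imsetP => -[]. Qed.

Lemma cmd_hash (A g : {set Ev}) : (Cmd g \in hash A) = false.
Proof. by apply/imsetP => -[]. Qed.

Lemma dollar_plain (A : {set Ev}) : (Dollar \in plain A) = false.
Proof. by apply/imsetP => -[]. Qed.

Lemma dollar_hash (A : {set Ev}) : (Dollar \in hash A) = false.
Proof. by apply/imsetP => -[]. Qed.

Lemma dollar_cmds (Sc : {set Ev}) : (Dollar \in cmds Sc) = false.
Proof. by apply/imsetP => -[]. Qed.

Definition mem_eventE :=
  (mem_plain, mem_hash, mem_cmds, plain_hash, plain_cmds, hash_plain,
   hash_cmds, cmd_plain, cmd_hash, dollar_plain, dollar_hash, dollar_cmds).

End Events.

(** * Comparison of the monitors of two supervisors, the second simulating the first *)

Section Monitors.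
Context {Ev Q X1 X2 : finType} (Sc So : {set Ev}) (G : automaton Ev Q).
Context (S1 : automaton Ev X1) (S2 : automaton Ev X2) (sim : X1 -> X2 -> Prop).
Hypothesis alphG : alph G = setT.
Hypothesis sup1 : supervisor setT Sc So S1.
Hypothesis sup2 : supervisor setT Sc So S2.
Hypothesis sim_step : forall u x s u', sim u x -> delta S1 u s = Some u' ->
  exists2 x', delta S2 x s = Some x' & sim u' x'.

(** Unobservable events do not move a supervisor, so its component is constant on an estimate; only
    the plant states need to be compared. *)
Definition sub_estimate (u : X1) (x : X2) (D1 : {set X1 * Q})
    (D2 : {set X2 * Q}) : Prop :=
  forall p, p \in D1 -> p.1 = u /\ (x, p.2) \in D2.

(** Along an unobservable string both supervisors stay put, the second one enabling every event by
    [sim_step], and the plant makes the same moves. *)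
Lemma sub_estimate_UR u x q :
  sim u x ->
  sub_estimate u x (UR (sync S1 G) (~: So) (u, q)) (UR (sync S2 G) (~: So) (x, q)).
Proof.
have [a1 _ _ loop1] := sup1; have [a2 _ _ loop2] := sup2 => ux p /URP[s sT rs].
suff [-> rs2]: p.1 = u /\ run (sync S2 G) (x, q) s = Some (x, p.2).
  by split=> //; apply/URP; exists s.
elim/last_ind: s p sT rs => [p _ [<-]|s e IH p] //.
rewrite all_rcons inE => /andP[eT sT] /run_rconsP[r /(IH _ sT)[r1 rs2]].
have eU (A : {set Ev}) : A = setT -> e \in A :\: So by move=> ->; rewrite !inE eT.
case/(delta_sync_setT _ _ _ a1 alphG); rewrite r1 => d1 dG.
have [x' d2 _] := sim_step ux d1.
split; first exact: loop1 (eU _ erefl) d1.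
apply/run_rconsP; exists (x, r.2) => //; apply/delta_sync_setT => //=; split=> //.
by rewrite d2 (loop2 _ _ _ (eU _ erefl) d2).
Qed.

Lemma monitor_init (X : finType) (S : automaton Ev X) :
  supervisor setT Sc So S ->
  init (proj_aut So (sync S G)) = UR (sync S G) (~: So) (init S, init G).
Proof. by case=> a _ _ _; rewrite /= a alphG setUT setTD. Qed.

Lemma sub_estimate_init :
  sim (init S1) (init S2) ->
  sub_estimate (init S1) (init S2) (init (proj_aut So (sync S1 G)))
    (init (proj_aut So (sync S2 G))).
Proof. by rewrite !monitor_init //; apply: sub_estimate_UR. Qed.

Lemma monitor_step (X : finType) (S : automaton Ev X) (D : {set X * Q}) s :
  supervisor setT Sc So S -> D != set0 ->
  delta (proj_aut So (sync S G)) D s =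
  Some (if s \in So then URset (sync S G) (~: So) (delta_set (sync S G) D s)
        else D).
Proof.
case=> a _ _ _ /negPf D0.
rewrite /delta /= a alphG setUT inE setTD D0.
by case: ifP.
Qed.

Lemma sub_estimate_step u x s u' x' (D1 : {set X1 * Q}) (D2 : {set X2 * Q}) :
  sim u' x' -> delta S1 u s = Some u' -> delta S2 x s = Some x' ->
  sub_estimate u x D1 D2 ->
  sub_estimate u' x'
    (URset (sync S1 G) (~: So) (delta_set (sync S1 G) D1 s))
    (URset (sync S2 G) (~: So) (delta_set (sync S2 G) D2 s)).
Proof.
have [a1 _ _ _] := sup1; have [a2 _ _ _] := sup2.
move=> ux' d1 d2 sub p /bigcupP[[v q]]; rewrite inE => /exists_inP[r /sub[r1 rD2]].
move=> /eqP/(delta_sync_setT _ _ _ a1 alphG)/=; rewrite r1 d1 => -[[<-] dG].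
case/(sub_estimate_UR ux') => -> px; split=> //; apply/bigcupP; exists (x', q) => //.
rewrite inE; apply/exists_inP; exists (x, r.2) => //.
by apply/eqP/delta_sync_setT.
Qed.

(** This covers the alarm raised when the attacker forges an event that the supervisor has
    disabled. *)
Lemma estimate_stuck u s (D1 : {set X1 * Q}) :
  {in D1, forall p, p.1 = u} -> delta S1 u s = None ->
  URset (sync S1 G) (~: So) (delta_set (sync S1 G) D1 s) = set0.
Proof.
have [a1 _ _ _] := sup1 => D1u d1.
suff -> : delta_set (sync S1 G) D1 s = set0 by rewrite /URset big_set0.
apply/setP => p; rewrite !inE; apply/exists_inP => -[r /D1u r1 /eqP].
by case/(delta_sync_setT _ _ _ a1 alphG); rewrite r1 d1.
Qed.

End Monitors.

(** * [Sdown] is simulated by every consistent supervisor *)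

Section Consistent.
Context {Ev Q U X : finType} (Sc So : {set Ev}) (G : automaton Ev Q).
Context (O : seq (seq Ev)) (MO : automaton Ev U) (ubot : U) (S : automaton Ev X).
Hypothesis alphG : alph G = setT.
Hypothesis hMO : observation_automaton So O MO ubot.
Hypothesis supS : supervisor setT Sc So S.
Hypothesis consS : consistent So G O S.

(** At [ubot] the state [x] is arbitrary: from there on [Sdown] enables uncontrollable events only
    and never leaves [ubot]. *)
Definition same_observation (u : U) (x : X) : Prop :=
  u = ubot \/
  exists2 w, run MO (init MO) w = Some u & run S (init S) w = Some x.

Lemma same_observation_step u x s u' :
  same_observation u x -> delta (Sdown Sc So MO ubot) u s = Some u' ->
  exists2 x', delta S x s = Some x' & same_observation u' x'.
Proof.
have [aS _ uc loop] := supS; have [_ _ OE dead _] := hMO => ux.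
have ucS : s \notin Sc -> exists x', delta S x s = Some x'.
  move=> sUc; case d: (delta S x s) => [x'|]; first by exists x'.
  by case: (uc x s _ d); rewrite !inE sUc.
rewrite /delta inE /= -/(delta S x s); case: ifP => [sSo|sUo].
  case dM: (delta MO u s) => [v|]; last first.
    by case: ifP => // /ucS[x' d] [<-]; exists x' => //; left.
  case=> <-; case: ux => [uE|[w wM wS]].
    (* [ubot] is deadlocked in [MO], so a move of [MO] rules it out. *)
    by have /dead/(_ s) := uE; rewrite dM.
  have wsM : run MO (init MO) (rcons w s) = Some v by apply/run_rconsP; exists u.
  (* The extended observation lies in [O], so consistency realizes it under [S]; as [S] is
     deterministic, its state after [w] is [x], where [s] is thus enabled. *)
  have /OE/consS[t [p tp] tE] : closed_behavior MO (rcons w s) by exists v.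
  have /(run_proj supS) := run_sync_fst aS alphG tp; rewrite tE => wsS.
  have /run_rconsP[x0] := wsS; rewrite wS => -[<-] d.
  by exists p.1 => //; right; exists (rcons w s).
case: ifP => // /ucS[x' d] [<-]; exists x' => //.
by rewrite (loop _ _ _ _ d) // !inE sUo.
Qed.

Lemma command_sub u x :
  same_observation u x ->
  command (Sdown Sc So MO ubot) u \subset command S x.
Proof.
move=> ux; apply/subsetP => s; rewrite !inE.
case d: (delta _ u s) => [u'|] // _.
by have [x' ->] := same_observation_step ux d.
Qed.

Lemma command_uc x : ~: Sc \subset command S x.
Proof.
have [_ _ uc _] := supS; apply/subsetP => s; rewrite !inE => sUc.
by apply/eqP; apply: uc; rewrite !inE sUc.
Qed.

End Consistent.

(** * Replaying attacked runs of [Sdown] under [S] *)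

Section Loop.
Context {Ev Q U X Y : finType} (Sc So : {set Ev}) (G : automaton Ev Q).
Context (qbad : Q) (O : seq (seq Ev)) (MO : automaton Ev U) (ubot : U).
Context (SaA SsA : {set Ev}) (R : {set Ev * Ev}) (Ao : automaton (event Ev) Y).
Context (S : automaton Ev X).
Hypothesis alphG : alph G = setT.
Hypothesis hMO : observation_automaton So O MO ubot.
Hypothesis SsA_So : SsA \subset So.
Hypothesis hA : attacker Sc So SaA SsA Ao.
Hypothesis supS : supervisor setT Sc So S.
Hypothesis consS : consistent So G O S.

Local Notation loop S := (attacked_loop Sc So SsA R G qbad S Ao).
Local Notation Sd := (Sdown Sc So MO ubot).

(** The alphabet of the attacker contains those of all other components, hence is that of the
    loop. *)
Lemma delta_loop (Z : finType) (T : automaton Ev Z) q b D sa ce y q' b' D' sa' ce' y' e :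
  delta (loop T) (q, b, D, sa, ce, y) e = Some (q', b', D', sa', ce', y') <->
  e \in alph Ao /\
  [/\ lstep (GT Sc SsA G qbad) q e = Some q',
      lstep (BTA Sc So SsA T) b e = Some b',
      lstep (monitorA Sc SsA (proj_aut So (sync T G))) D e = Some D',
      lstep (GSA SsA R) sa e = Some sa' &
      lstep (GCE Sc So) ce e = Some ce' /\ lstep Ao y e = Some y'].
Proof.
have -> : (e \in alph Ao) = (e \in alph (loop T)).
  case: hA => aA _ _ _; rewrite /= aA.
  by case: e => *; rewrite !inE !mem_eventE ?inE ?orbF ?orbT ?orbb.
split.
  move=> /deltaE[eA]; rewrite /attacked_loop.
  by move=> /lstep_sync[/= /lstep_sync[/= /lstep_sync[/= /lstep_sync[/=
    /lstep_sync[/= h1 h2] h3] h4] h5] h6].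
case=> eA [h1 h2 h3 h4 [h5 h6]]; apply/deltaE; split=> //.
by do 5! [apply/lstep_sync; split=> //=].
Qed.

Definition bt_of (Z : finType) (com : bool) (z : Z) : bt_state Z :=
  if com then BtCom z else BtSt z.

Definition command_le (ce ce' : option {set Ev}) : Prop :=
  match ce, ce' with
  | Some g, Some g' => g \subset g'
  | None, None => True
  | _, _ => False
  end.

(** Only supervisor states, estimates and commands in force may differ. [BtBang] is absent because a
    related run that enters it empties the [Sdown] estimate. *)
Variant loop_sim :
  option Q * bt_state U * option {set U * Q} * option Ev * option {set Ev} * Y ->
  option Q * bt_state X * option {set X * Q} * option Ev * option {set Ev} * Y ->
  Prop :=
  LoopSim q com u x D1 D2 sa ce ce' y of
    same_observation MO ubot S u x & D1 != set0 & sub_estimate u x D1 D2 &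
    command_le ce ce' :
    loop_sim (q, bt_of com u, Some D1, sa, ce, y)
             (q, bt_of com x, Some D2, sa, ce', y).

Definition doomed
    (p : option Q * bt_state U * option {set U * Q} * option Ev * option {set Ev} * Y) :
    Prop :=
  let: (q, _, D, _, _, _) := p in
  q != Some qbad /\ (D == None) || (D == Some set0).

(** An empty estimate permits only [$], which sends the plant to its dead state [None] and the
    monitor likewise. *)
Lemma doomed_step p e r : doomed p -> delta (loop Sd) p e = Some r -> doomed r.
Proof.
case: p => [[[[[q b] D] sa] ce] y]; case: r => [[[[[q' b'] D'] sa'] ce'] y'].
move=> [qb D0] /delta_loop[eA [+ _ + _ _]].
have [aA _ _ _] := hA; move: eA; rewrite aA /lstep /= => ->.
case/orP: D0 => /eqP-> //=.
rewrite /delta /= eqxx.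
case: e => [s|s||g] /=; rewrite ?if_same //.
by case: q qb => // q _; case: ifP => // _ [<-] [<-].
Qed.

Lemma loop_sim_step p p' e r :
  loop_sim p p' -> delta (loop Sd) p e = Some r ->
  [\/ exists e' r', delta (loop S) p' e' = Some r' /\ loop_sim r r',
      exists e' r', delta (loop S) p' e' = Some r' /\ r' \in marked (loop S) |
      doomed r].
Proof.
have supd := Sdown_supervisor Sc So MO ubot.
have simS := same_observation_step alphG hMO supS consS.
have [aA mA ucA loopA] := hA.
case=> {p p'} q com u x D1 D2 sa ce ce' y ux D10 sub ceg.
case: r => [[[[[q' b'] D'] sa'] cer] y'].
have D20 : D2 != set0.
  by case/set0Pn: D10 => d /sub[_ h]; apply/set0Pn; exists (x, d.2).
have D1u : {in D1, forall d, d.1 = u} by move=> d /sub[].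
move=> /delta_loop[eA [hG hB hD hSA [hCE hY]]].
have fullE e' : (e' \in alph Ao) =
    (e' \in plain setT :|: hash SsA :|: [set Dollar] :|: cmds Sc) by rewrite aA.
case: e eA hG hB hD hSA hCE hY => [s|s||g] eA hG hB hD hSA hCE hY.
- have [g gE [sg cerE]] : exists2 g, ce = Some g &
      s \in g /\ cer = if s \in So then None else Some g.
    move: hCE; rewrite /lstep /= !(inE, mem_eventE) /=.
    case: ce ceg => // g _; case: ifP => // sg.
    by case: ifP => _ [<-]; exists g.
  have [g' g'E gg'] : exists2 g', ce' = Some g' & g \subset g'.
    by case: ce' ceg; rewrite gE // => g' gg'; exists g'.
  pose cer' := if s \in So then None else Some g'.
  have hCE' : lstep (GCE Sc So) ce' (Plain s) = Some cer'.
    rewrite /lstep /= !(inE, mem_eventE) /= g'E (subsetP gg' _ sg) /cer'.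
    by case: ifP.
  have cegr : command_le cer cer' by rewrite cerE /cer'; case: ifP.
  (* An event of [SsA] moves neither supervisor nor monitor; they react to the relabelled copy sent
     by the attacker. *)
  case sA: (s \in SsA).
    have [hB1 hD1] : b' = bt_of com u /\ D' = Some D1.
      move: hB hD; rewrite /lstep /= !(inE, mem_eventE) /= sA D10 => hB [<-].
      by split=> //; move: hB; rewrite /bt_of; case: (com) => -[].
    constructor 1; exists (Plain s), (q', bt_of com x, Some D2, sa', cer', y').
    split; last by rewrite hB1 hD1; constructor.
    apply/delta_loop; split=> //; split=> //.
      by rewrite /lstep /= !(inE, mem_eventE) /= /bt_of; case: (com); rewrite sA.
    by rewrite /lstep /= !(inE, mem_eventE) /= sA D20.
  have [u' comE [du bE]] : exists2 u', com = false & delta Sd u s = Some u' /\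
      b' = bt_of (s \in So) u'.
    move: hB; rewrite /lstep /= !(inE, mem_eventE) /=.
    case: com => /=; rewrite sA //; case: ifP => sSo.
      by case: (delta Sd u s) => // u' [<-]; exists u'.
    case d: (delta Sd u s) => [u'|] // [<-]; exists u' => //; split=> //.
    by have [_ _ _ lp] := supd; rewrite (lp _ _ _ _ d) // !inE sSo.
  have [x' dx ux'] := simS _ _ _ _ ux du.
  pose D2' := if s \in So then URset (sync S G) (~: So) (delta_set (sync S G) D2 s)
              else D2.
  have hD2 : lstep (monitorA Sc SsA (proj_aut So (sync S G))) (Some D2) (Plain s) =
      Some (Some D2').
    by rewrite /lstep /= !(inE, mem_eventE) /= sA (monitor_step alphG _ supS D20).
  move: hD; rewrite /lstep /= !(inE, mem_eventE) /= sA.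
  rewrite (monitor_step alphG _ supd D10) => -[DE].
  have stp : delta (loop S) (q, bt_of com x, Some D2, sa, ce', y) (Plain s) =
      Some (q', bt_of (s \in So) x', Some D2', sa', cer', y').
    apply/delta_loop; split=> //; split=> //.
    rewrite comE /lstep /= !(inE, mem_eventE) /= sA dx.
    case: ifP => // sSo; have [_ _ _ lp] := supS.
    by rewrite (lp _ _ _ _ dx) // !inE sSo.
  have sub' : sub_estimate u' x' (if s \in So
      then URset (sync Sd G) (~: So) (delta_set (sync Sd G) D1 s) else D1) D2'.
    rewrite /D2'; case: ifP => sSo.
      exact: (sub_estimate_step alphG supd supS simS ux' du dx sub).
    have [_ _ _ lp] := supS; have [_ _ _ lpd] := supd.
    by rewrite (lp _ _ _ _ dx) ?(lpd _ _ _ _ du) // !inE sSo.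
  rewrite bE -DE; set D1' := if _ then _ else D1 in sub' *.
  (* The replay [stp] is legal even if the [Sdown] estimate is now empty; in that case it inflicts
     damage or the original run is doomed, according to whether [q'] is bad. *)
  case: (eqVneq D1' set0) => [D1'0|D1'0]; last first.
    constructor 1; exists (Plain s), (q', bt_of (s \in So) x', Some D2', sa', cer', y').
    by split=> //; constructor.
  case: (eqVneq q' (Some qbad)) => [qE|qN]; last first.
    by constructor 3; split=> //; rewrite D1'0 eqxx orbT.
  constructor 2; exists (Plain s), (q', bt_of (s \in So) x', Some D2', sa', cer', y').
  by split=> //; rewrite !inE qE mA !inE eqxx.
- have sA : s \in SsA by move: eA; rewrite fullE !(inE, mem_eventE) /= !orbF.
  have sSo := subsetP SsA_So _ sA.
  (* A relabelled event is enabled only away from [qbad] and leaves the plant in place, so an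
     estimate emptied by it dooms the run. *)
  have [qE qN] : q' = q /\ q' != Some qbad.
    move: hG; rewrite /lstep /= !(inE, mem_eventE) /= sA /=.
    by case: q => // q; case: ifP => // qN [<-].
  have cE : cer = ce by move: hCE; rewrite /lstep /= !(inE, mem_eventE) /= => -[].
  move: hD; rewrite /lstep /= !(inE, mem_eventE) /= sA.
  rewrite (monitor_step alphG _ supd D10) sSo => -[DE].
  case du: (delta Sd u s) => [u'|]; last first.
    constructor 3; split=> //.
    by rewrite -DE (estimate_stuck alphG supd D1u du) eqxx orbT.
  have [x' dx ux'] := simS _ _ _ _ ux du.
  have [comE bE] : com = false /\ b' = BtCom u'.
    move: hB; rewrite /lstep /= !(inE, mem_eventE) /= sA /=.
    by case: com => //=; rewrite du => -[<-].
  have sub' := sub_estimate_step alphG supd supS simS ux' du dx sub.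
  set D1' := URset _ _ _ in DE sub'.
  case: (eqVneq D1' set0) => [D1'0|D1'0].
    by constructor 3; split=> //; rewrite -DE D1'0 eqxx orbT.
  constructor 1.
  exists (Hash s), (q', bt_of true x', Some (URset (sync S G) (~: So)
    (delta_set (sync S G) D2 s)), sa', ce', y').
  split; last by rewrite bE -DE cE qE; apply: (@LoopSim _ true).
  apply/delta_loop; split=> //; split=> //.
  + by rewrite comE /lstep /= !(inE, mem_eventE) /= sA /= dx.
  + by rewrite /lstep /= !(inE, mem_eventE) /= sA /= (monitor_step alphG _ supS D20) sSo.
  + by split=> //; rewrite /lstep /= !(inE, mem_eventE).
(* The monitor allows [$] only at the empty estimate. *)
- by move: hD; rewrite /lstep /= !(inE, mem_eventE) /= (negPf D10).
- have gSc : ~: Sc \subset g by move: eA; rewrite fullE !(inE, mem_eventE) /=.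
  have [qE qN] : q' = q /\ q' != Some qbad.
    move: hG; rewrite /lstep /= !(inE, mem_eventE) /= gSc /=.
    by case: q => // q; case: ifP => // qN [<-].
  have [comE bE gE] : [/\ com = true, b' = BtSt u & g = command Sd u].
    move: hB; rewrite /lstep /= !(inE, mem_eventE) /= gSc /=.
    by case: com => //=; case: eqP => // -> [<-].
  have DE : D' = Some D1.
    by move: hD; rewrite /lstep /= !(inE, mem_eventE) /= gSc /= D10 => -[].
  have [ceE cerE] : ce = None /\ cer = Some g.
    move: hCE; rewrite /lstep /= !(inE, mem_eventE) /= gSc /=.
    by case: (ce) => // -[].
  have ce'E : ce' = None by move: ceg; rewrite ceE; case: (ce').
  have saE : sa' = sa by move: hSA; rewrite /lstep /= !(inE, mem_eventE) => -[].
  have g'Sc : ~: Sc \subset command S x := command_uc supS x.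
  (* Commands are unobservable for the attacker, hence self-loops, and uncontrollable for it, hence
     always defined: exchanging one for another keeps it at [y]. *)
  have uobs (h : {set Ev}) : ~: Sc \subset h -> Cmd h \in alph Ao :\: (plain So :|: hash SsA).
    by move=> hSc; rewrite in_setD fullE !(inE, mem_eventE) hSc.
  have yE : y' = y.
    apply: (loopA _ (Cmd g)); first by rewrite -aA uobs.
    by apply/deltaE.
  have dY : delta Ao y (Cmd (command S x)) = Some y.
    case d: (delta Ao y _) => [y1|].
      by congr Some; apply: loopA d; rewrite -aA uobs.
    by case: (ucA y (Cmd (command S x))) => //; rewrite !(inE, mem_eventE) g'Sc.
  constructor 1; exists (Cmd (command S x)),
    (q', bt_of false x, Some D2, sa', Some (command S x), y').
  split; last first.
    rewrite bE DE cerE gE; apply: (@LoopSim _ false) => //.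
    exact: (command_sub alphG hMO supS consS ux).
  have [eA' lY] := (deltaE _ _ _ _).1 dY.
  apply/delta_loop; split=> //; split=> //.
  + rewrite qE; move: qN; rewrite qE /lstep /= !(inE, mem_eventE) /= g'Sc /=.
    by move: hG; rewrite /lstep /= !(inE, mem_eventE) gSc /=; case: (q) => // q0; case: ifP.
  + by rewrite comE /lstep /= !(inE, mem_eventE) /= g'Sc /= eqxx.
  + by rewrite /lstep /= !(inE, mem_eventE) /= g'Sc /= D20.
  + by rewrite saE /lstep /= !(inE, mem_eventE).
  + by rewrite ce'E yE; split=> //; rewrite /lstep /= !(inE, mem_eventE) g'Sc.
Qed.

Lemma loop_sim_run s r :
  run (loop Sd) (init (loop Sd)) s = Some r ->
  [\/ exists s' r', run (loop S) (init (loop S)) s' = Some r' /\ loop_sim r r',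
      damage_inflicting Sc So SsA R G qbad S Ao |
      doomed r].
Proof.
have supd := Sdown_supervisor Sc So MO ubot.
have simS := same_observation_step alphG hMO supS consS.
elim/last_ind: s r => [r [<-]|s e IH r].
  constructor 1; exists [::], (init (loop S)); split=> //.
  have ux : same_observation MO ubot S (init Sd) (init S) by right; exists [::].
  have D0 : init (proj_aut So (sync Sd G)) != set0.
    apply/set0Pn; exists (init Sd, init G).
    by rewrite (monitor_init alphG supd) inE connect0.
  apply: (@LoopSim _ true _ _ _ _ _ None None _ ux D0) => //.
  exact: (sub_estimate_init alphG supd supS simS ux).
case/run_rconsP=> p /IH[[s' [p' [rs' sim]]] step|dmg _|/doomed_step dp /dp].
- case: (loop_sim_step sim step) => [[e' [r' [d rr]]]|[e' [r' [d mr]]]|dr].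
  + by constructor 1; exists (rcons s' e'), r'; split=> //; apply/run_rconsP; exists p'.
  + constructor 2; exists (rcons s' e'), r' => //.
    by apply/run_rconsP; exists p'.
  + by constructor 3.
- by constructor 2.
- by constructor 3.
Qed.

End Loop.

Theorem theorem1 (Ev Q U Y : finType)
    (Sc So : {set Ev}) (G : automaton Ev Q) (qbad : Q)
    (hG : plant G qbad)
    (O : seq (seq Ev)) (hO : observations Sc So G O)
    (MO : automaton Ev U) (ubot : U)
    (hMO : observation_automaton So O MO ubot)
    (SaA SsA : {set Ev}) (R : {set Ev * Ev})
    (hR : attack_constraint Sc So SaA SsA R)
    (Ao : automaton (event Ev) Y) (hA : attacker Sc So SaA SsA Ao)
    (hne : nonempty_attacker Sc So SsA R G qbad MO Ao)
    (hsafe : safe Sc So SsA R G qbad MO Ao)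
    (hdown : exists s, marked_behavior
       (attacked_loop Sc So SsA R G qbad (Sdown Sc So MO ubot) Ao) s) :
  forall (X : finType) (S : automaton Ev X),
    supervisor setT Sc So S -> consistent So G O S ->
    damage_inflicting Sc So SsA R G qbad S Ao.
Proof.
move=> X S supS consS; case: hG => alphG _ _ _; case: hR => _ SsA_So _ _.
case: hdown => s [r rs rm].
have [_ mA _ _] := hA.
case: (loop_sim_run alphG hMO SsA_So hA supS consS rs) => // [[s' [r' [rs' sim]]]|].
  (* Related states share the plant state, so the replay ends in a marked state too; a doomed final
     state is not marked. *)
  exists s', r' => //; case: sim rm => q com u x D1 D2 sa ce ce' y _ _ _ _.
  by rewrite !inE mA !inE.
case: r rm {rs} => [[[[[q b] D] sa] ce] y]; rewrite !inE => rm [qN /orP[]/eqP DE].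
  by move: rm; rewrite DE eqxx !andbF.
by move: rm; rewrite (negPf qN).
Qed.
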